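(* Let $D=(V,E)$ be a digraph of order $n$ and let $\alpha\in[0,1]$. Let $Z=\sum_{v\in V}(d^+(v))^2$ and let $c_2=\sum_{u,v\in V}A(D)_{uv}A(D)_{vu}$ be the number of closed walks of length $2$ in $D$. Let $\rho(D)$ be the spectral radius of $A_\alpha(D)$. Then $$\rho(D)\ge\sqrt{\frac{\alpha^2 Z+(1-\alpha)^2 c_2}{n}}.$$ Equality holds if and only if one of the following occurs: (i) $\alpha=0$ and either $D$ is a DAG (directed acyclic graph), or every strong component of $D$ is a digon $\overleftrightarrow{K_2}$; (ii) $0<\alpha<1$ and $D$ is an empty digraph; (iii) $\alpha=1$ and $D$ is out-regular, i.e. $d^+(v)$ is constant for all $v\in V$.
   Context: A digraph $D=(V,E)$ has a finite nonempty vertex set $V$ and an arc set $E\subseteq V\times V$ without self-loops (an arc $(u,v)\in E$ is written $u\to v$; both $u\to v$ and $v\to u$ may be present). $d^+(v)$ is the out-degree of $v$. The adjacency matrix $A(D)$ has $(u,v)$-entry $1$ if $u\to v$ is an arc and $0$ otherwise; $\mathrm{Deg}(D)$ is the diagonal matrix of out-degrees; $A_\alpha(D)=\alpha\,\mathrm{Deg}(D)+(1-\alpha)A(D)$. The spectral radius is the maximum modulus of the eigenvalues. A strong component is the subdigraph induced on a maximal set of mutually reachable vertices. The digon $\overleftrightarrow{K_2}$ is the digraph on two vertices with both opposite arcs. A DAG has no directed cycle (a digon counts as a directed cycle). An empty digraph is one with no arcs. *)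

(* Defs.v *)
From mathcomp Require Import all_boot all_order all_algebra.
From mathcomp Require Import complex.
From mathcomp Require Import classical_sets reals.

Set Implicit Arguments.
Unset Strict Implicit.
Unset Printing Implicit Defensive.

Import Order.TTheory GRing.Theory Num.Theory.

Local Open Scope ring_scope.

Record digraph (V : finType) := Digraph {
  arc :> rel V;
  arc_irreflexive : irreflexive arc;
  order_gt0 : (0 < #|V|)%N
}.

Section Digraph.
Variables (V : finType) (D : digraph V).

Definition outdeg (v : V) : nat := #|[set w | D v w]|.

(* Directed cycles are nonempty vertex-simple cycles; those of length 2 are
   the digons. *)
Definition is_dag : Prop := forall c : seq V, ucycle D c -> c = [::].

Definition is_empty : Prop := forall u v : V, ~~ D u v.

Definition out_regular : Prop := exists k : nat, forall v : V, outdeg v = k.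

Definition mutually_reachable (S : {set V}) : bool :=
  [forall u in S, forall v in S, connect D u v].

(* Strong components are represented by their vertex sets. *)
Definition strong_component (S : {set V}) : bool :=
  maxset mutually_reachable S.

(* The subdigraph of D induced on S is a digon. *)
Definition induces_digon (S : {set V}) : Prop :=
  exists u v : V, [/\ u != v, S = [set u; v], D u v & D v u].

End Digraph.

(* The vertices index the matrices through the enumeration of V. *)
Section Matrices.
Variables (R : realType) (V : finType) (D : digraph V).

Definition adjmx : 'M[R]_#|V| :=
  \matrix_(i, j) (D (enum_val i) (enum_val j))%:R.

Definition outdegmx : 'M[R]_#|V| :=
  diag_mx (\row_i (outdeg D (enum_val i))%:R).

Definition alphamx (alpha : R) : 'M[R]_#|V| :=
  alpha *: outdegmx + (1 - alpha) *: adjmx.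

Definition sum_sqr_outdeg : R := \sum_(v : V) (outdeg D v)%:R ^+ 2.

Definition closed_walks2 : R := \sum_i \sum_j adjmx i j * adjmx j i.

End Matrices.

Section SpectralRadius.
Variables (R : realType) (n : nat).

(* The eigenvalues of a real matrix are taken in the complex numbers; for
   0 < n the supremum is a maximum (spectral_radius_max). *)
Definition spectral_radius (M : 'M[R]_n) : R :=
  sup [set r | exists2 z : R[i],
         eigenvalue (map_mx (real_complex R) M) z & r = Normc.normc z]%classic.

Lemma spectral_radius_max (M : 'M[R]_n) : (0 < n)%N ->
  (exists2 z : R[i], eigenvalue (map_mx (real_complex R) M) z
                     & spectral_radius M = Normc.normc z) /\
  (forall z : R[i], eigenvalue (map_mx (real_complex R) M) z ->
     Normc.normc z <= spectral_radius M).
Proof.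
move=> n_gt0; rewrite /spectral_radius; set A := map_mx _ M.
set E := (X in sup X).
have [rs Ers] := closed_field_poly_normal (char_poly A).
have lc : lead_coef (char_poly A) = 1 by apply/monicP; exact: char_poly_monic.
have evE z : eigenvalue A z = (z \in rs).
  by rewrite eigenvalue_root_char Ers lc scale1r root_prod_XsubC.
have [z0 [rs' Drs]] : exists z0 rs', rs = z0 :: rs'.
  case: rs Ers {evE} => [|z0 rs' _]; last by exists z0, rs'.
  rewrite big_nil lc scale1r => /(congr1 (fun p : {poly _} => size p)).
  by rewrite size_char_poly size_poly1 => -[] n0; move: n_gt0; rewrite n0.
have [z zrs zmax] : exists2 z, z \in rs &
    forall y, y \in rs -> Normc.normc y <= Normc.normc z.
  rewrite {}Drs {evE Ers}; elim: rs' z0 => [|z1 s IHs] z0.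
    by exists z0 => [|y]; rewrite inE // => /eqP->.
  have [z zs zmax] := IHs z1.
  have [le0 | lt0] := leP (Normc.normc z0) (Normc.normc z).
    exists z => [|y]; first by rewrite inE zs orbT.
    by rewrite inE => /predU1P[-> // | /zmax].
  exists z0 => [|y]; first by rewrite inE eqxx.
  by rewrite inE => /predU1P[-> // | /zmax/le_trans]; apply; exact: ltW.
suff -> : sup E = Normc.normc z.
  by split=> [|y]; [exists z; rewrite ?evE | rewrite evE => /zmax].
have Ez : E (Normc.normc z) by exists z; rewrite ?evE.
have ubE : ubound E (Normc.normc z) by move=> _ [y + ->]; rewrite evE => /zmax.
apply/eqP; rewrite eq_le; apply/andP; split.
  by apply: ge_sup => //; exists (Normc.normc z).
by apply: ub_le_sup => //; exists (Normc.normc z).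
Qed.

End SpectralRadius.

(* Main.v *)
(** Since [A_alpha] has trace of square [alpha^2 Z + (1 - alpha)^2 c_2], and this
    trace is the sum of the squares of the [n] complex eigenvalues, it is at
    most [n rho^2]. Equality forces every eigenvalue to be [rho] or [- rho], so
    that [tr B^k = n s^k] for all [k], where [B = A_alpha^2] and [s = rho^2].
    As [B] is nonnegative, this forces [(B^k)_uu = s^k] at every vertex [u], so no
    closed walk of [B] leaves its base vertex. For [0 < alpha < 1] the arcs of [D]
    are in the support of [B], so [D] is acyclic and has a sink, whence [s = 0].
    For [alpha = 0], either [s = 0] and [D] is a DAG, or each vertex lies in a
    digon, and acyclicity of [B] leaves no room for anything else in its strong
    component. *)

Require Import Defs.
From mathcomp Require Import all_boot all_order all_algebra.
From mathcomp Require Import complex.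
From mathcomp Require Import classical_sets reals.
From mathcomp Require Import ring.

Set Implicit Arguments.
Unset Strict Implicit.
Unset Printing Implicit Defensive.

Import Order.TTheory GRing.Theory Num.Theory.
Local Open Scope ring_scope.

(** * Traces of powers as power sums of eigenvalues *)

Lemma trig_mxX (R : comPzRingType) n (T : 'M[R]_n) k : is_trig_mx T ->
  is_trig_mx (T ^+ k) /\ forall i, (T ^+ k) i i = T i i ^+ k.
Proof.
move=> /is_trig_mxP trigT; elim: k => [|k [/is_trig_mxP trigTk IHk]].
  by split=> [|i]; rewrite ?scalar_mx_is_trig // mxE eqxx.
(* If l < i, then l < j and the entry of [T ^+ k] lies above the diagonal; if i < l, the entry of
   [T] does. *)
have off (i j l : 'I_n) : (i <= j)%N -> l != i -> T i l * (T ^+ k) l j = 0.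
  move=> le_ij; rewrite neq_ltn => /orP[lt_li | lt_il].
    by rewrite trigTk ?mulr0 // (leq_trans lt_li).
  by rewrite trigT ?mul0r.
split=> [|i].
  apply/is_trig_mxP => i j lt_ij; rewrite exprS mxE big1 // => l _.
  have [->|ne_li] := eqVneq l i; first by rewrite trigTk ?mulr0.
  by rewrite off // ltnW.
rewrite exprS mxE (bigD1 i) //= big1 ?addr0 ?IHk ?exprS // => l ne_li.
exact: off.
Qed.

(** Schur triangularization: the diagonal of the triangular form lists the eigenvalues with
    multiplicity, and its k-th power carries their k-th powers on the diagonal. *)
Lemma eigenvalue_power_sums (C : numClosedFieldType) n (A : 'M[C]_n) :
    (0 < n)%N ->
  exists t : 'I_n -> C, (forall i, eigenvalue A (t i)) /\
    forall k, \tr (A ^+ k) = \sum_i t i ^+ k.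
Proof.
move=> n_gt0; have [P /unitarymx_unit uP] := Schur A n_gt0.
rewrite /similar_to /= conjumx // => trigT; set T := _ *m _ in trigT.
exists (fun i => T i i); split=> [i|k].
  have : eigenvalue T (T i i).
    rewrite eigenvalue_root_char char_poly_trig //.
    rewrite -(big_map (fun j => T j j) xpredT (fun a => 'X - a%:P)) root_prod_XsubC.
    by apply/mapP; exists i; rewrite ?mem_index_enum.
  case/eigenvalueP=> v vT v0; apply/eigenvalueP; exists (v *m P).
    by rewrite scalemxAl -vT !mulmxA mulmxKV.
  apply: contra v0 => /eqP/(congr1 (mulmx^~ (invmx P))).
  by rewrite mulmxK // mul0mx => ->.
have TX : T ^+ k = P *m A ^+ k *m invmx P.
  elim: k => [|k IHk]; first by rewrite !expr0 mulmx1 mulmxV.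
  rewrite !exprS IHk -[RHS]/(P *m (A *m A ^+ k) *m invmx P) -[LHS]/(T *m _).
  by rewrite !mulmxA mulmxKV.
have [_ dT] := trig_mxX k trigT.
rewrite -(eq_bigr _ (fun i _ => dT i)) -/(mxtrace _) TX mxtrace_mulC mulmxA.
by rewrite mulVmx ?mul1mx.
Qed.

(** * Growth of powers *)

Lemma bernoulli_le (R : realDomainType) (e : R) k :
  0 <= e -> 1 + e *+ k <= (1 + e) ^+ k.
Proof.
move=> e0; elim: k => [|k IHk]; first by rewrite addr0.
rewrite exprSr mulrDr mulr1 mulrSr addrA lerD // ler_peMl //.
by rewrite (le_trans _ IHk) // lerDl mulrn_wge0.
Qed.

(** If a > s > 0, then a / s = 1 + e with e > 0, and Bernoulli's inequality lets its powers exceed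
    any c. For s = 0 the exponent 1 already suffices. *)
Lemma expr_bound_le (R : archiRealFieldType) (a c s : R) : 0 <= s ->
  (forall k, (0 < k)%N -> a ^+ k <= c * s ^+ k) -> a <= s.
Proof.
move=> s0 ac; rewrite leNgt; apply/negP => lt_sa.
have a0 := le_lt_trans s0 lt_sa.
have [s_eq0|s_neq0] := eqVneq s 0.
  by have := ac 1 isT; rewrite s_eq0 mulr0 leNgt a0.
have s_gt0 : 0 < s by rewrite lt_def s_neq0.
pose e := a / s - 1.
have e_gt0 : 0 < e by rewrite subr_gt0 ltr_pdivlMr // mul1r.
have [k] : exists k, `|c| / e < k%:R.
  by exists (Num.bound (`|c| / e)); rewrite archi_boundP // divr_ge0 // ltW.
rewrite ltr_pdivrMr // => lt_ck.
have := @bernoulli_le _ e k.+1 (ltW e_gt0).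
have -> : 1 + e = a / s by rewrite addrC subrK.
rewrite expr_div_n => /le_trans-/(_ c).
rewrite ler_pdivrMr ?exprn_gt0 // ac // => /(_ isT); apply/negP; rewrite -ltNge.
rewrite (le_lt_trans (ler_norm c)) // (lt_trans lt_ck) //.
by rewrite mulr_natl mulrSr addrCA ltrDl ltr_pwDl // ltW.
Qed.

(** * Nonnegative matrices whose powers have geometric traces *)

Section NonnegativeMatrices.
Variables (R : archiRealFieldType) (n : nat).
Implicit Types M N : 'M[R]_n.

Lemma mulmx_entry_ge M N i j k : (forall i j, 0 <= M i j) -> (forall i j, 0 <= N i j) ->
  M i j * N j k <= (M *m N) i k.
Proof.
move=> M0 N0; rewrite mxE (bigD1 j) //= lerDl sumr_ge0 // => l _.
by rewrite mulr_ge0.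
Qed.

Lemma mxX_ge0 M k i j : (forall i j, 0 <= M i j) -> 0 <= (M ^+ k) i j.
Proof.
move=> M0; elim: k i j => [|k IHk] i j; first by rewrite mxE; case: eqP.
by rewrite exprS mxE sumr_ge0 // => l _; rewrite mulr_ge0.
Qed.

Lemma mxX_diag_ge M k u : (forall i j, 0 <= M i j) -> M u u ^+ k <= (M ^+ k) u u.
Proof.
move=> M0; elim: k => [|k IHk]; first by rewrite mxE eqxx.
rewrite !exprS.
apply: (le_trans _ (mulmx_entry_ge u u u M0 (fun i j => mxX_ge0 k i j M0))).
by rewrite ler_wpM2l.
Qed.

Lemma mxX_connect M u v : (forall i j, 0 <= M i j) ->
  connect (fun i j => M i j != 0) u v -> exists k, 0 < (M ^+ k) u v.
Proof.
move=> M0 /connectP[p]; elim: p u => [|w p IHp] u /=.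
  by move=> _ ->; exists 0; rewrite mxE eqxx ltr01.
move=> /andP[Muw /IHp{}IHp] /IHp[k Mk]; exists k.+1; rewrite exprS.
apply: (lt_le_trans _ (mulmx_entry_ge u w v M0 (fun i j => mxX_ge0 k i j M0))).
by rewrite mulr_gt0 // lt_def Muw M0.
Qed.

Variables (M : 'M[R]_n) (s : R).
Hypotheses (M_ge0 : forall i j, 0 <= M i j) (s_ge0 : 0 <= s).
Hypothesis trMX : forall k, (0 < k)%N -> \tr (M ^+ k) = n%:R * s ^+ k.

Let MX_ge0 k i j : 0 <= (M ^+ k) i j. Proof. exact: mxX_ge0. Qed.

(** Repeating closed walks gives ((M^k)_vv)^m <= (M^(km))_vv <= n s^(km) for all m > 0, so (M^k)_vv
    <= s^k by [expr_bound_le]. These n entries add up to n s^k, so none is smaller. *)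
Lemma constant_trace_diag k u : (0 < k)%N -> (M ^+ k) u u = s ^+ k.
Proof.
move=> k_gt0; have le_s v : (M ^+ k) v v <= s ^+ k.
  apply: (@expr_bound_le _ _ n%:R) => [|m m_gt0]; first exact: exprn_ge0.
  rewrite (le_trans (mxX_diag_ge _ _ _)) // -!exprM -trMX ?muln_gt0 ?k_gt0 //.
  by rewrite /mxtrace (bigD1 v) //= lerDl sumr_ge0.
have /psumr_eq0P/(_ u isT)/eqP : \sum_v (s ^+ k - (M ^+ k) v v) = 0.
  by rewrite sumrB -/(mxtrace _) trMX // sumr_const card_ord mulr_natl subrr.
by rewrite subr_eq0 => /(_ (fun v _ => etrans (subr_ge0 _ _) (le_s v))) /eqP.
Qed.

(** Expand (M^(k+l))_uu over the vertex reached after k steps. The vertex u alone contributes s^k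
    s^l, which is the whole entry, so the positive contribution of some v distinct from u has no
    room. *)
Lemma constant_trace_acyclic u v :
    connect (fun i j => M i j != 0) u v -> connect (fun i j => M i j != 0) v u ->
  u = v.
Proof.
move=> /mxX_connect-/(_ M_ge0)[k kuv] /mxX_connect-/(_ M_ge0)[l lvu].
apply/eqP/negPn/negP => ne_uv.
have k_gt0 : (0 < k)%N by case: k kuv => //; rewrite mxE (negPf ne_uv) ltxx.
have l_gt0 : (0 < l)%N by case: l lvu => //; rewrite mxE eq_sym (negPf ne_uv) ltxx.
have := constant_trace_diag u (ltn_addr l k_gt0).
rewrite exprD -[_ * _]/(_ *m _) mxE (bigD1 u) //= (bigD1 v) 1?eq_sym //=.
rewrite !constant_trace_diag // -exprD => /eqP; rewrite -subr_eq0 addrAC subrr add0r.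
by rewrite gt_eqF // ltr_pwDl ?mulr_gt0 ?sumr_ge0 // => i _; rewrite mulr_ge0.
Qed.

End NonnegativeMatrices.

(** * The spectral radius and the trace of the square *)

Section SpectralRadiusTraces.
Variables (R : realType) (n : nat) (A : 'M[R]_n).
Hypothesis n_gt0 : (0 < n)%N.
Local Notation rho := (spectral_radius A).
Local Notation AC := (map_mx (real_complex R) A).

Lemma spectral_radius_ge0 : 0 <= rho.
Proof.
have [[z _ ->] _] := spectral_radius_max A n_gt0.
by rewrite -lecR; exact: (normr_ge0 z).
Qed.

Lemma spectral_radius_constant c :
  (forall z, eigenvalue AC z -> Normc.normc z = c) -> rho = c.
Proof. by have [[z Az ->] _] := spectral_radius_max A n_gt0; apply. Qed.

Lemma real_power_sums : exists t : 'I_n -> R[i],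
  (forall i, `|t i ^+ 2| <= (rho ^+ 2)%:C%C) /\
  forall k, (\tr (A ^+ k))%:C%C = \sum_i t i ^+ k.
Proof.
have [t [At trA]] := eigenvalue_power_sums AC n_gt0.
exists t; split=> [i|k].
  rewrite normrX rmorphXn /= lerXn2r ?nnegrE ?normr_ge0 ?ler0c ?spectral_radius_ge0 //.
  by rewrite lecR (proj2 (spectral_radius_max A n_gt0)).
have map_mxX : map_mx (real_complex R) (A ^+ k) = AC ^+ k.
  elim: k => [|k IHk]; first by rewrite !expr0 map_mx1.
  by rewrite !exprS -IHk; exact: map_mxM.
by rewrite -trA -map_mxX trace_map_mx.
Qed.

Lemma trace_sqr_le : \tr (A ^+ 2) <= n%:R * rho ^+ 2.
Proof.
have [t [t_le trA]] := real_power_sums.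
have : `|(\tr (A ^+ 2))%:C%C| <= n%:R * (rho ^+ 2)%:C%C.
  rewrite trA (le_trans (ler_norm_sum _ _ _)) //.
  rewrite (le_trans (ler_sum _ (fun i _ => t_le i))) //.
  by rewrite sumr_const card_ord mulr_natl.
rewrite normc_def /= expr0n addr0 sqrtr_sqr -(rmorph_nat (real_complex R)).
by rewrite -rmorphM lecR; apply/le_trans/ler_norm.
Qed.

(** The squared eigenvalues are n complex numbers of modulus at most rho^2 with sum n rho^2, so each
    of them equals rho^2. *)
Lemma trace_sqr_eq : \tr (A ^+ 2) = n%:R * rho ^+ 2 ->
  forall k, \tr ((A ^+ 2) ^+ k) = n%:R * (rho ^+ 2) ^+ k.
Proof.
have [t [t_le trA]] := real_power_sums => tr2 k.
have sum_t2 : \sum_i t i ^+ 2 = \sum_(i < n) (rho ^+ 2)%:C%C.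
  by rewrite -trA tr2 sumr_const card_ord rmorphM rmorph_nat mulr_natl.
have t2 i : t i ^+ 2 = (rho ^+ 2)%:C%C.
  exact: (normC_sum_upper (fun i _ => t_le i) sum_t2).
apply: complexI; rewrite -exprM trA (eq_bigr (fun _ => ((rho ^+ 2) ^+ k)%:C%C)).
  by rewrite sumr_const card_ord rmorphM rmorph_nat mulr_natl.
by move=> i _; rewrite exprM t2 -rmorphXn.
Qed.

End SpectralRadiusTraces.

Lemma spectral_radius_scalar (R : realType) n (c : R) : (0 < n)%N ->
  spectral_radius (c%:M : 'M_n) = `|c|.
Proof.
move=> n_gt0; apply: spectral_radius_constant => // z /eigenvalueP[v].
rewrite map_scalar_mx mul_mx_scalar => /eqP; rewrite -subr_eq0 -scalerBl scaler_eq0.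
move=> /orP[|->] //; rewrite subr_eq0 => /eqP <- _.
by rewrite /Normc.normc /= expr0n addr0 sqrtr_sqr.
Qed.

(** * The matrix [alphamx] and the diagonal of its square *)

Section AlphaMatrix.
Variables (R : realType) (V : finType) (D : digraph V) (alpha : R).
Local Notation M := (alphamx D alpha).
Local Notation deg i := ((outdeg D (enum_val i))%:R : R).
Local Notation A := (adjmx R D).

Definition digon_count (i : 'I_#|V|) : R := \sum_j A i j * A j i.

Lemma alphamxE i j : M i j = alpha * (deg i *+ (i == j)) + (1 - alpha) * A i j.
Proof. by rewrite !mxE. Qed.

Lemma adjmx_diag i : A i i = 0.
Proof. by rewrite mxE arc_irreflexive. Qed.

(** Without loops, the cross terms between degrees and adjacency vanish on the diagonal. *)
Lemma alphamx_sqr_diag i :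
  (M ^+ 2) i i = alpha ^+ 2 * deg i ^+ 2 + (1 - alpha) ^+ 2 * digon_count i.
Proof.
rewrite expr2 mxE /digon_count mulr_sumr (bigD1 i) //= [in RHS](bigD1 i) //=.
rewrite !alphamxE adjmx_diag eqxx mulr1n addrA; congr (_ + _); first by ring.
apply: eq_bigr => j /negPf ne_ji.
by rewrite !alphamxE [i == j]eq_sym ne_ji !mulr0n; ring.
Qed.

Lemma trace_alphamx_sqr : \tr (M ^+ 2) =
  alpha ^+ 2 * sum_sqr_outdeg R D + (1 - alpha) ^+ 2 * closed_walks2 R D.
Proof.
rewrite /sum_sqr_outdeg (reindex (fun i : 'I_#|V| => enum_val i)) /=; last first.
  exact/onW_bij/enum_val_bij.
by rewrite !mulr_sumr -big_split; apply: eq_bigr => i _; exact: alphamx_sqr_diag.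
Qed.

Hypothesis halpha : 0 <= alpha <= 1.

Lemma alphamx_ge0 i j : 0 <= M i j.
Proof.
case/andP: halpha => a0 a1.
by rewrite alphamxE mxE addr_ge0 ?mulr_ge0 ?subr_ge0 ?mulrn_wge0 ?ler0n.
Qed.

End AlphaMatrix.

(** * Reachability in finite relations *)

Section Reachability.
Variable T : finType.
Implicit Types e : rel T.

Lemma connect_homo (T' : finType) e (e' : rel T') (f : T -> T') :
    (forall x y, e x y -> connect e' (f x) (f y)) ->
  forall x y, connect e x y -> connect e' (f x) (f y).
Proof.
move=> ef x y /connectP[p]; elim: p x => [|z p IHp] x /= => [_ ->|].
  exact: connect0.
by move=> /andP[/ef xz /IHp{}IHp] /IHp; apply: connect_trans.
Qed.

(** Take x in P with the fewest reachable points. Any y in P reached from x reaches no more than x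
    does, hence by minimality exactly the same points, x included. *)
Lemma terminal_connect e (P : pred T) x0 : P x0 ->
  exists2 x, P x & forall y, P y -> connect e x y -> connect e y x.
Proof.
move=> Px0; case: (arg_minnP (fun x => #|connect e x|) Px0) => x Px xmin.
exists x => // y Py xy; have sub : connect e y \subset connect e x.
  by apply/fintype.subsetP => z; exact: connect_trans.
have /fintype.subsetP : connect e x \subset connect e y.
  by rewrite -(geq_leqif (subset_leqif_card sub)) xmin.
by apply; apply: connect0.
Qed.

End Reachability.

(** * Directed cycles and strong components *)

Section DigraphReachability.
Variables (V : finType) (D : digraph V).

(** A walk from v back to u shortens to a vertex-simple path, which the arc closes into a simple
    cycle as in [is_dag]. *)
Lemma dag_connectF u v : is_dag D -> D u v -> ~~ connect D v u.
Proof.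
move=> dagD Duv; apply/negP => /connectP[p]; case/shortenP => q vq Uq _ u_last.
suff: v :: q = [::] by [].
by apply: dagD; rewrite /ucycle /= rcons_path vq -u_last Duv.
Qed.

Lemma dag_of_connectF : (forall u v, D u v -> ~~ connect D v u) -> is_dag D.
Proof.
move=> acyc [|u p] //= /andP[Dp _]; move: Dp => /=.
case E: (rcons p u) => [|v q] /=; first by case: p E.
case/andP=> /acyc/negP acyc_vu vq; case: acyc_vu; apply/connectP; exists q => //.
by rewrite -[last v q]/(last v (v :: q)) -E last_rcons.
Qed.

Lemma mutually_reachable_class u :
  strong_component D [set v | connect D u v && connect D v u].
Proof.
apply/maxsetP; split=> [|S /forall_inP mrS /fintype.subsetP cS].
  apply/forall_inP => v; rewrite inE => /andP[_ vu].
  by apply/forall_inP => w; rewrite inE => /andP[uw _]; exact: connect_trans uw.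
have uS : u \in S by apply: cS; rewrite inE connect0.
apply/eqP; rewrite finset.eqEsubset; apply/andP; split; last exact/fintype.subsetP.
apply/fintype.subsetP => v vS; rewrite inE.
by rewrite (forall_inP (mrS u uS) v vS) (forall_inP (mrS v vS) u uS).
Qed.

Lemma strong_componentP S : strong_component D S ->
  exists u, S = [set v | connect D u v && connect D v u].
Proof.
move=> /maxsetP[/forall_inP mrS maxS].
have [S0|[u uS]] := finset.set_0Vmem S.
  (* A maximal empty set would have to equal the class of any vertex, which contains it. *)
  have [u _] := card_gt0P (Defs.order_gt0 D); exists u.
  have /maxsetP[mr _] := mutually_reachable_class u.
  by rewrite [RHS]maxS // S0 finset.sub0set.
exists u; apply/esym/maxS.
  by have /maxsetP[] := mutually_reachable_class u.
apply/fintype.subsetP => v vS; rewrite inE.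
by rewrite (forall_inP (mrS u uS) v vS) (forall_inP (mrS v vS) u uS).
Qed.

Lemma digon_components_partner :
    (forall S, strong_component D S -> induces_digon D S) ->
  forall u, exists u', [/\ D u u', D u' u &
    forall v, connect D u v -> connect D v u -> v = u \/ v = u'].
Proof.
move=> digonD u.
have [a [b [_ Sab Dab Dba]]] := digonD _ (mutually_reachable_class u).
have: u \in [set a; b] by rewrite -Sab inE connect0.
have mem v : connect D u v -> connect D v u -> v \in [set a; b].
  by move=> uv vu; rewrite -Sab inE uv.
rewrite in_set2 => /orP[] /eqP Eu; [exists b | exists a].
  split=> [||v uv vu]; rewrite ?Eu //.
  by have := mem v uv vu; rewrite in_set2 => /orP[] /eqP; auto.
split=> [||v uv vu]; rewrite ?Eu //.
by have := mem v uv vu; rewrite in_set2 => /orP[] /eqP; auto.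
Qed.

Local Notation D2 := [rel u v | [exists w, D u w && D w v]].

Lemma two_step u w v : D u w -> D w v -> connect D2 u v.
Proof. by move=> uw wv; apply/connect1/existsP; exists w; rewrite uw. Qed.

(* Every vertex [u] has a unique digon partner [f u], which shifts every walk to
   one of the other parity; hence a closed walk through [u] is met by two-step
   walks in both directions at [u] or at [f u]. *)
Lemma digon_components (f : V -> V) :
    (forall u, D u (f u) && D (f u) u) ->
    (forall u v, connect D2 u v -> connect D2 v u -> u = v) ->
  forall S, strong_component D S -> induces_digon D S.
Proof.
move=> Df acyc S /strong_componentP[u ->].
have Duf x : D x (f x) by case/andP: (Df x).
have Dfu x : D (f x) x by case/andP: (Df x).
(* Two-step walks join x and f (f x) in both directions through f x. *)
have fK x : f (f x) = x.
  apply: acyc; first exact: two_step (Dfu _) (Dfu _).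
  exact: two_step (Duf _) (Duf _).
(* A two-step walk x, w, y extends to f x, x, w, y, f y, which splits at w into two two-step
   walks. *)
have shift x y : connect D2 x y -> connect D2 (f x) (f y).
  apply: connect_homo => {}x {}y /existsP[w /andP[xw wy]].
  by apply: connect_trans (two_step (Dfu _) xw) (two_step wy (Duf _)).
have ne_f x : x != f x.
  by apply: contraTneq (Duf x) => <-; rewrite arc_irreflexive.
have parity x y : connect D x y -> connect D2 x y \/ connect D2 (f x) y.
  case/connectP=> p; elim: p x => [|w p IHp] x /=.
    by move=> _ ->; left; apply: connect0.
  move=> /andP[xw /IHp{}IHp] /IHp[wy|fwy]; [right|left].
    exact: connect_trans (two_step (Dfu x) xw) wy.
  exact: connect_trans (two_step xw (Duf w)) fwy.
have oddF x : ~ connect D2 x (f x).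
  move=> xf; have := shift _ _ xf; rewrite fK => fx.
  by have := ne_f x; rewrite -(acyc _ _ xf fx) eqxx.
have oddF' x : ~ connect D2 (f x) x by have := oddF (f x); rewrite fK.
exists u, (f u); split=> //; apply/setP => v; rewrite !inE.
apply/andP/idP => [[uv vu] | /orP[]/eqP ->]; last 2 first.
- by split; apply: connect0.
- by split; apply: connect1.
case: (parity _ _ uv) (parity _ _ vu) => [{}uv|{}uv] [{}vu|{}vu].
- by rewrite (acyc _ _ vu uv) eqxx.
- by case: (oddF u); apply: connect_trans uv _; have := shift _ _ vu; rewrite fK.
- by case: (oddF' u); apply: connect_trans uv vu.
- have vfu : connect D2 v (f u) by have := shift _ _ vu; rewrite fK.
  by rewrite (acyc _ _ vfu uv) eqxx orbT.
Qed.

End DigraphReachability.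

(** * Necessity of the conditions for equality *)

Lemma alphamx0 (R : realType) (V : finType) (D : digraph V) :
  alphamx D 0 = adjmx R D.
Proof. by rewrite /alphamx scale0r add0r subr0 scale1r. Qed.

Section EqualityCase.
Variables (R : realType) (V : finType) (D : digraph V) (alpha : R).
Hypothesis halpha : 0 <= alpha <= 1.
Local Notation M := (alphamx D alpha).
Local Notation A := (adjmx R D).
Local Notation rho := (spectral_radius M).
Hypothesis trM : \tr (M ^+ 2) = #|V|%:R * rho ^+ 2.

Let V_gt0 : (0 < #|V|)%N := Defs.order_gt0 D.
Let M_ge0 i j : 0 <= M i j. Proof. exact: alphamx_ge0. Qed.
Let B_ge0 i j : 0 <= (M ^+ 2) i j. Proof. exact: mxX_ge0. Qed.
Let trB k : (0 < k)%N -> \tr ((M ^+ 2) ^+ k) = #|V|%:R * (rho ^+ 2) ^+ k.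
Proof. by move=> _; apply: trace_sqr_eq. Qed.

Lemma equality_diagX k i : (0 < k)%N -> ((M ^+ 2) ^+ k) i i = (rho ^+ 2) ^+ k.
Proof. exact: constant_trace_diag B_ge0 (sqr_ge0 _) trB k i. Qed.

Lemma equality_diag v : alpha ^+ 2 * (outdeg D v)%:R ^+ 2
    + (1 - alpha) ^+ 2 * digon_count R D (enum_rank v) = rho ^+ 2.
Proof.
have := equality_diagX (enum_rank v) (ltn0Sn 0).
by rewrite !expr1 alphamx_sqr_diag enum_rankK.
Qed.

(** The relation [e] is left free to serve both for the arcs of D, when 0 < alpha < 1, and for
    two-step walks, when alpha = 0. *)
Lemma equality_acyclic (e : rel V) u v :
    (forall x y, e x y -> (M ^+ 2) (enum_rank x) (enum_rank y) != 0) ->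
  connect e u v -> connect e v u -> u = v.
Proof.
move=> eB uv vu; apply: enum_rank_inj.
have homo x y : connect e x y ->
    connect (fun i j => (M ^+ 2) i j != 0) (enum_rank x) (enum_rank y).
  by apply: connect_homo => {}x {}y /eB xy; apply: connect1.
exact: (constant_trace_acyclic B_ge0 (sqr_ge0 _) trB) (homo _ _ uv) (homo _ _ vu).
Qed.

Lemma adjmx_rank u v : A (enum_rank u) (enum_rank v) = (D u v)%:R.
Proof. by rewrite mxE !enum_rankK. Qed.

Lemma equality_empty : 0 < alpha < 1 -> is_empty D.
Proof.
move=> /andP[a0 a1] u0 v0; apply/negP => Duv0.
have outdeg_gt0 u v : D u v -> (0 < outdeg D u)%N.
  by move=> Duv; apply/card_gt0P; exists v; rewrite inE.
have rho_gt0 : 0 < rho ^+ 2.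
  have outdeg_u0 := outdeg_gt0 _ _ Duv0.
  rewrite -(equality_diag u0) ltr_pwDl ?mulr_gt0 ?exprn_gt0 ?ltr0n //.
  by rewrite mulr_ge0 ?sqr_ge0 // sumr_ge0 // => j _; rewrite !mxE mulr_ge0 ?ler0n.
(* A vertex without out-arcs would have a zero diagonal entry in [M ^+ 2], whereas all these entries
   equal rho^2 > 0. *)
have arc_out u : exists v, D u v.
  have [v Duv|noD] := pickP (D u); first by exists v.
  move: rho_gt0; rewrite -(equality_diag u) /outdeg.
  have -> : [set w | D u w] = finset.set0 by apply/setP => w; rewrite !inE noD.
  rewrite cards0 expr0n mulr0 add0r /digon_count big1 ?mulr0 ?ltxx // => j _.
  by rewrite -[j]enum_valK adjmx_rank noD mul0r.
(* Everything v reaches leads back to v. Its out-neighbour w then lies in the same class, so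
   acyclicity gives v = w, a loop. *)
have [v _ vmin] := @terminal_connect V D predT u0 isT.
have [w Dvw] := arc_out v.
have vw : v = w.
  apply: (@equality_acyclic D); last exact/vmin/connect1; last exact: connect1.
  (* Staying at x before taking the arc contributes M_xx M_xy = alpha d^+(x) (1 - alpha) > 0. *)
  move=> x y Dxy; rewrite gt_eqF // expr2.
  apply: lt_le_trans (mulmx_entry_ge _ (enum_rank x) _ M_ge0 M_ge0).
  have ne_xy : x == y = false.
    by apply: contraTF Dxy => /eqP ->; rewrite arc_irreflexive.
  rewrite !alphamxE !adjmx_rank arc_irreflexive eqxx (inj_eq enum_rank_inj) ne_xy.
  rewrite enum_rankK Dxy mulr1n mulr0n !mulr0 addr0 add0r mulr1.
  by rewrite !mulr_gt0 ?subr_gt0 ?ltr0n ?(outdeg_gt0 _ _ Dxy).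
by move: Dvw; rewrite vw arc_irreflexive.
Qed.

Lemma equality_out_regular : alpha = 1 -> out_regular D.
Proof.
move=> a1; have [v0 _] := card_gt0P V_gt0; exists (outdeg D v0) => v.
have := equality_diag v; rewrite -(equality_diag v0) a1 subrr expr1n expr0n.
rewrite !mul0r !addr0 !mul1r.
by move=> /eqP; rewrite eqrXn2 ?ler0n // eqr_nat => /eqP.
Qed.

Lemma equality_dag_or_digons : alpha = 0 ->
  is_dag D \/ forall S : {set V}, strong_component D S -> induces_digon D S.
Proof.
move=> a0; have MA : M = A by rewrite a0 alphamx0.
have A_ge0 i j : 0 <= A i j by rewrite mxE ler0n.
have [rho0|rho_neq0] := eqVneq (rho ^+ 2) 0; [left|right].
  apply: dag_of_connectF => u v Duv; apply/negP => vu.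
  have /mxX_connect-/(_ A_ge0)[k Ak] :
      connect (fun i j => A i j != 0) (enum_rank v) (enum_rank u).
    apply: connect_homo vu => x y Dxy; apply: connect1.
    by rewrite adjmx_rank Dxy oner_eq0.
  have Ak1 : 0 < (A ^+ k.+1) (enum_rank u) (enum_rank u).
    have Ak_ge0 i j := mxX_ge0 k i j A_ge0.
    rewrite exprS; apply: lt_le_trans (mulmx_entry_ge _ (enum_rank v) _ A_ge0 Ak_ge0).
    by rewrite adjmx_rank Duv mul1r.
  (* Only even powers of A are known to have zero diagonal, so the closed walk of length k + 1 is
     traversed twice. *)
  have := equality_diagX (enum_rank u) (ltn0Sn k).
  rewrite rho0 expr0n /= -exprM mulnC exprM MA => A0.
  have := mxX_diag_ge 2 (enum_rank u) (fun i j => mxX_ge0 k.+1 i j A_ge0).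
  by rewrite A0 leNgt exprn_gt0.
(* For alpha = 0 the diagonal entry rho^2 at u counts the digons at u, so it being nonzero provides
   one. *)
have partner u : exists v, D u v && D v u.
  have [v Duv|noD] := pickP (fun v => D u v && D v u); first by exists v.
  case/eqP: rho_neq0; rewrite -(equality_diag u) a0 expr0n mul0r add0r /digon_count.
  rewrite big1 ?mulr0 // => j _; rewrite -[j]enum_valK !adjmx_rank -natrM mulnb.
  by rewrite noD.
have /fin_all_exists[f Df] := partner.
apply: (digon_components Df) => u v.
apply: equality_acyclic => x y /existsP[w /andP[xw wy]].
rewrite MA expr2 gt_eqF //.
apply: lt_le_trans (mulmx_entry_ge _ (enum_rank w) _ A_ge0 A_ge0).
by rewrite !adjmx_rank xw wy mulr1.
Qed.

End EqualityCase.

(** * Adjacency eigenvalues and closed 2-walks for DAGs and digon components *)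

Section Adjacency.
Variables (R : realType) (V : finType) (D : digraph V).
Local Notation A := (adjmx R D).
Local Notation AC := (map_mx (real_complex R) A).

(* A nonzero eigenvector of [A] restricts to a strong component which is minimal
   among those meeting its support. *)
Lemma adjmx_eigenfunction z : eigenvalue AC z -> exists2 f : V -> R[i],
  (forall y, z * f y = \sum_(x | D x y) f x) &
  exists2 y, f y != 0 & forall x, f x != 0 -> connect D x y -> connect D y x.
Proof.
case/eigenvalueP=> v vA v_neq0; pose f x := v 0 (enum_rank x).
have [x0 fx0] : exists x, f x != 0.
  apply/existsP; apply: contraNT v_neq0 => /existsPn f0; apply/eqP/rowP => i.
  by have /negPn/eqP := f0 (enum_val i); rewrite /f enum_valK mxE.
exists f => [y|].
  (* [eigenvalue] refers to row vectors, so the sum runs over in-neighbours. *)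
  have /rowP/(_ (enum_rank y)) := vA; rewrite !mxE => <-.
  rewrite (reindex enum_rank) /=; last exact/onW_bij/enum_rank_bij.
  rewrite [RHS]big_mkcond; apply: eq_bigr => x _; rewrite mxE adjmx_rank.
  by case: (D x y); rewrite ?rmorph1 ?mulr1 ?rmorph0 ?mulr0.
(* Reversing the arcs yields a support vertex with the fewest ancestors. *)
have [y fy ymin] := @terminal_connect V (fun x y => D y x) (fun x => f x != 0) x0 fx0.
exists y => // x fx; by have := ymin x fx; rewrite !(connect_rev D).
Qed.

(** At the chosen y, an in-neighbour in the support would lie on a cycle with y. Hence z f(y) = 0
    with f(y) nonzero. *)
Lemma adjmx_dag_eigenvalue z : is_dag D -> eigenvalue AC z -> z = 0.
Proof.
move=> dagD /adjmx_eigenfunction[f zf [y fy ymin]].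
apply/eqP; have := mulf_eq0 z (f y); rewrite (negPf fy) orbF => <-; rewrite zf.
rewrite big1 // => x Dxy; apply/eqP; apply: contraNT (dag_connectF dagD Dxy) => fx.
exact: ymin (connect1 Dxy).
Qed.

(** The only in-neighbour of y that can lie in the support is its digon partner y', and vice versa.
    So multiplication by z swaps f(y) and f(y'), whence z^2 = 1, unless f(y') = 0 and then z = 0. *)
Lemma adjmx_digons_eigenvalue z :
    (forall S, strong_component D S -> induces_digon D S) ->
  eigenvalue AC z -> Normc.normc z <= 1.
Proof.
move=> /digon_components_partner partner /adjmx_eigenfunction[f zf [y fy ymin]].
have step u u' : D u u' -> D u' u ->
    (forall v, connect D u v -> connect D v u -> v = u \/ v = u') ->
    (forall v, f v != 0 -> connect D v u -> connect D u v) ->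
  z * f u = f u'.
  move=> uu' u'u only_u' umin; rewrite zf (bigD1 u') //= big1 ?addr0 // => x.
  case/andP=> xu ne_xu'; apply/eqP; apply: contraNT ne_xu' => fx.
  have xCu := connect1 xu; case: (only_u' x (umin x fx xCu) xCu) => [E|-> //].
  by move: xu; rewrite E arc_irreflexive.
have [y' [yy' y'y only_y']] := partner y.
have zy := step y y' yy' y'y only_y' ymin.
have [fy'0|fy'] := eqVneq (f y') 0.
  have /eqP : z * f y = 0 by rewrite zy.
  by rewrite mulf_eq0 (negPf fy) orbF => /eqP ->; rewrite Normc.normc0 ler01.
have zy' : z * f y' = f y.
  apply: step => // v.
    move=> y'v vy'; have := only_y' v (connect_trans (connect1 yy') y'v).
    by case=> [|->|->]; [exact: connect_trans vy' (connect1 y'y) | right | left].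
  move=> fv vy'; apply: connect_trans (connect1 y'y) _.
  exact: ymin fv (connect_trans vy' (connect1 y'y)).
have z2 : z ^+ 2 = 1.
  by apply: (mulIf fy); rewrite mul1r expr2 -mulrA zy zy'.
have : `|z| ^+ 2 = 1 by rewrite -normrX z2 normr1.
by move/eqP; rewrite sqrp_eq1 ?normr_ge0 // => /eqP[->].
Qed.

Lemma closed_walks2_dag : is_dag D -> closed_walks2 R D = 0.
Proof.
move=> dagD; apply: big1 => i _; apply: big1 => j _; rewrite !mxE -natrM mulnb.
case: (boolP (D _ _)) => //= Dij; case: (boolP (D _ _)) => //= Dji.
by have := dag_connectF dagD Dij; rewrite connect1.
Qed.

(** Each vertex starts exactly one closed 2-walk, the one through its partner. *)
Lemma closed_walks2_digons :
    (forall S, strong_component D S -> induces_digon D S) ->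
  closed_walks2 R D = #|V|%:R.
Proof.
move=> /digon_components_partner partner.
transitivity (\sum_(i < #|V|) (1 : R)); last by rewrite sumr_const card_ord.
apply: eq_bigr => i _.
have [v' [vv' v'v only_v']] := partner (enum_val i).
rewrite (bigD1 (enum_rank v')) //= big1 => [|j ne_jv'].
  by rewrite !mxE enum_rankK vv' v'v mulr1 addr0.
rewrite !mxE -natrM mulnb; case: andP => // -[Dij Dji].
case: (only_v' _ (connect1 Dij) (connect1 Dji)) => E.
  by move: Dij; rewrite E arc_irreflexive.
by move: ne_jv'; rewrite -E enum_valK eqxx.
Qed.

End Adjacency.

(** * Empty and out-regular digraphs: scalar matrices *)

Lemma alphamx_empty (R : realType) (V : finType) (D : digraph V) (alpha : R) :
  is_empty D -> alphamx D alpha = 0%:M.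
Proof.
move=> emptyD; apply/matrixP => i j; rewrite alphamxE !mxE (negPf (emptyD _ _)).
rewrite /outdeg; have -> : [set w | D (enum_val i) w] = finset.set0.
  by apply/setP => w; rewrite !inE (negPf (emptyD _ _)).
by rewrite cards0 !mul0rn !mulr0 addr0.
Qed.

Lemma alphamx1_out_regular (R : realType) (V : finType) (D : digraph V) k :
  (forall v, outdeg D v = k) -> alphamx D (1 : R) = k%:R%:M.
Proof.
by move=> regD; apply/matrixP => i j; rewrite alphamxE regD subrr mul0r addr0 mul1r mxE.
Qed.

(** * From traces to the bound and its equality cases *)

Lemma sqrt_div_le (R : rcfType) (n : nat) (t r : R) : (0 < n)%N -> 0 <= r ->
  t <= n%:R * r ^+ 2 -> Num.sqrt (t / n%:R) <= r.
Proof.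
move=> n0 r0 t_le; rewrite -[leRHS]ger0_norm // -sqrtr_sqr ler_wsqrtr //.
by rewrite ler_pdivrMr ?ltr0n // mulrC.
Qed.

Lemma sqrt_div_eq (R : rcfType) (n : nat) (t r : R) : (0 < n)%N -> 0 <= r -> 0 <= t ->
  r = Num.sqrt (t / n%:R) <-> t = n%:R * r ^+ 2.
Proof.
move=> n_gt0 r_ge0 t_ge0; have n_neq0 : n%:R != 0 :> R by rewrite pnatr_eq0 -lt0n.
split=> [->|->]; first by rewrite sqr_sqrtr ?divr_ge0 ?ler0n // mulrC divfK.
by rewrite mulrAC mulfV // mul1r sqrtr_sqr ger0_norm.
Qed.

Theorem theorem3p4 (R : realType) (V : finType) (D : digraph V) (alpha : R)
    (halpha : 0 <= alpha <= 1) :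
  let rho := spectral_radius (alphamx D alpha) in
  let bound := Num.sqrt ((alpha ^+ 2 * sum_sqr_outdeg R D
                          + (1 - alpha) ^+ 2 * closed_walks2 R D) / #|V|%:R) in
  bound <= rho /\
  (rho = bound <->
     [\/ alpha = 0 /\
           (is_dag D \/
            forall S : {set V}, strong_component D S -> induces_digon D S),
         0 < alpha < 1 /\ is_empty D
       | alpha = 1 /\ out_regular D]).
Proof.
move=> rho bound; have V_gt0 := Defs.order_gt0 D.
have rho_ge0 : 0 <= rho by apply: spectral_radius_ge0.
have tr_ge0 : 0 <= \tr (alphamx D alpha ^+ 2).
  by apply: sumr_ge0 => i _; apply: mxX_ge0 => {}i j; apply: alphamx_ge0.
have tr_le := trace_sqr_le (alphamx D alpha) V_gt0.
rewrite {}/bound -trace_alphamx_sqr; split; first exact: sqrt_div_le.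
apply: iff_trans (sqrt_div_eq V_gt0 rho_ge0 tr_ge0) _; split=> [trM|].
  case: (eqVneq alpha 0) => [a0|a_neq0].
    by constructor 1; split=> //; apply: equality_dag_or_digons trM a0.
  case: (eqVneq alpha 1) => [a1|a_neq1].
    by constructor 3; split=> //; apply: equality_out_regular trM a1.
  have a01 : 0 < alpha < 1.
    by case/andP: halpha => a0 a1; rewrite !lt_def a_neq0 eq_sym a_neq1 a0.
  by constructor 2; split=> //; apply: equality_empty trM a01.
(* For c I the spectral radius is |c| and the trace of the square is n c^2; this settles the empty
   and the out-regular case. *)
have scalar c : alphamx D alpha = c%:M ->
    \tr (alphamx D alpha ^+ 2) = #|V|%:R * rho ^+ 2.
  move=> Mc; rewrite /rho Mc spectral_radius_scalar // real_normK ?num_real //.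
  by rewrite expr2 -[_ * _]/(_ *m _) -scalar_mxM mxtrace_scalar mulr_natl.
case=> [[a0]|[_ /alphamx_empty emptyM]|[a1 [k /alphamx1_out_regular regM]]].
- case=> [dagD|digonD].
    have rho0 : rho = 0.
      apply: spectral_radius_constant => // z; rewrite a0 alphamx0.
      by move=> /(adjmx_dag_eigenvalue dagD) ->; exact: Normc.normc0.
    rewrite trace_alphamx_sqr closed_walks2_dag // a0 rho0.
    by rewrite !expr0n !mul0r !mulr0 addr0.
  (* The trace is n here, so beyond the general inequality only rho <= 1 remains to be shown. *)
  apply/eqP; rewrite eq_le tr_le trace_alphamx_sqr closed_walks2_digons // a0.
  rewrite expr0n mul0r add0r subr0 expr1n mul1r ler_piMr ?ler0n // expr_le1 //.
  have [[z Mz rhoE] _] := spectral_radius_max (alphamx D alpha) V_gt0.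
  rewrite a0 alphamx0 in Mz.
  have -> : rho = Normc.normc z by [].
  exact: adjmx_digons_eigenvalue digonD Mz.
- exact: scalar (emptyM _ _).
- by apply: (scalar k%:R); rewrite a1.
Qed.
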